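(* Let $\lambda$ be a regular cardinal with $\lambda>\aleph_0$, and let $D$ be a filter on $\lambda$ which extends the club filter on $\lambda$ (i.e. every closed unbounded subset of $\lambda$ belongs to $D$). Let $\mathcal{M}$ and $\mathcal{N}$ be structures in the same vocabulary. If $\mathcal{M}$ and $\mathcal{N}$ are $EF_\lambda$-equivalent, then the reduced powers $\mathcal{M}^\lambda/D$ and $\mathcal{N}^\lambda/D$ are $EF_{\lambda^+}$-equivalent.
   Context: For an ordinal $\alpha$, two structures $\mathcal{A},\mathcal{B}$ in the same vocabulary are called $EF_\alpha$-equivalent if the second player (the ''isomorphism'' player, II) has a winning strategy in the Ehrenfeucht-Fraïssé game of length $\alpha$ on $\mathcal{A}$ and $\mathcal{B}$. In this game there are $\alpha$ rounds; in each round player I picks an element of one of the two structures and player II responds with an element of the other structure. Player II wins if the resulting correspondence between the elements chosen in $\mathcal{A}$ and the elements chosen in $\mathcal{B}$ is a partial isomorphism (it preserves atomic formulas in both directions). $\mathcal{M}^\lambda/D$ denotes the reduced power of $\mathcal{M}$ modulo the filter $D$. *)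

(* Defs.v *)
From mathcomp Require Import all_boot all_order.
From mathcomp Require Import generic_quotient.
From mathcomp Require Import all_classical wochoice.

Set Implicit Arguments.
Unset Strict Implicit.
Unset Printing Implicit Defensive.

Local Open Scope order_scope.
Local Open Scope classical_set_scope.
Local Open Scope card_scope.
Local Open Scope quotient_scope.

(* An ordinal is represented by a well-ordered [orderType]; its elements play
  the role of the smaller ordinals, and a cardinal is an initial ordinal. *)

Definition is_ordinal d (A : orderType d) : Prop :=
  well_order (<=%O : rel A).

Definition below d (A : orderType d) (a : A) : set A := [set b | b < a].

Definition is_cardinal d (A : orderType d) : Prop :=
  is_ordinal A /\ forall a : A, ~ ([set: A] #<= below a).

Definition unbounded d (A : orderType d) (C : set A) : Prop :=
  forall a, exists2 c, C c & a <= c.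

(* An infinite cardinal is regular when no unbounded subset has smaller
   cardinality, i.e. when it equals its own cofinality. *)
Definition is_regular d (A : orderType d) : Prop :=
  [/\ is_cardinal A, infinite_set [set: A] &
      forall C : set A, unbounded C -> C #= [set: A]].

(* [B] is the cardinal successor of [A]: the least ordinal whose cardinality
   exceeds that of [A]. *)
Definition is_succ_cardinal d d' (A : orderType d) (B : orderType d') : Prop :=
  [/\ is_ordinal B, ~ ([set: B] #<= [set: A]) &
      forall b : B, below b #<= [set: A]].

Definition is_limit d (A : orderType d) (a : A) : Prop :=
  (exists b, b < a) /\ forall b, b < a -> exists2 c, b < c & c < a.

Definition is_closed d (A : orderType d) (C : set A) : Prop :=
  forall a, is_limit a ->
    (forall b, b < a -> exists c, [/\ C c, b <= c & c < a]) -> C a.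

Definition is_club d (A : orderType d) (C : set A) : Prop :=
  is_closed C /\ unbounded C.

Record vocabulary := Vocabulary {
  fsym : Type;
  rsym : Type;
  farity : fsym -> nat;
  rarity : rsym -> nat
}.

Record structure (voc : vocabulary) := Structure {
  carrier :> Type;
  finterp : forall s : fsym voc, ('I_(farity s) -> carrier) -> carrier;
  rinterp : forall s : rsym voc, ('I_(rarity s) -> carrier) -> Prop;
  carrier_inhabited : inhabited carrier
}.

Inductive term (voc : vocabulary) (V : Type) : Type :=
| Var of V
| App (s : fsym voc) of ('I_(farity s) -> term voc V).

Inductive atomic (voc : vocabulary) (V : Type) : Type :=
| Equal of term voc V & term voc V
| Rel (s : rsym voc) of ('I_(rarity s) -> term voc V).

Fixpoint eval voc V (M : structure voc) (e : V -> M) (t : term voc V) : M :=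
  match t with
  | Var v => e v
  | App s ts => finterp (fun k => eval e (ts k))
  end.

Definition sat voc V (M : structure voc) (e : V -> M) (p : atomic voc V) : Prop :=
  match p with
  | Equal t u => eval e t = eval e u
  | Rel s ts => rinterp (fun k => eval e (ts k))
  end.

(* The correspondence [e v <-> e' v], [v : V], is a partial isomorphism.  The
   atomic formulas have their variables indexed by [V] itself; equality is
   among them, so the correspondence is the graph of an injective function. *)
Definition partial_iso voc V (M N : structure voc) (e : V -> M) (e' : V -> N) :
  Prop := forall p : atomic voc V, sat e p <-> sat e' p.

(* A move of player I is an element of [M + N]: the structure and the element
  picked in it.  Player II answers in the other structure. *)

Definition answer (M N : Type) (x : M + N) : Type :=
  match x with inl _ => N | inr _ => M end.

Definition matched (M N : Type) (x : M + N) : answer x -> M * N :=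
  match x with
  | inl m => fun n => (m, n)
  | inr n => fun m => (m, n)
  end.

(* A strategy of II in the game whose rounds are indexed by [A]: the answer in
   round [a] depends on the moves of I in the earlier rounds and on the current
   one (the earlier answers of II are determined by these). *)
Definition strategy d (A : orderType d) (M N : Type) : Type :=
  forall a : A, ({b : A | b < a} -> M + N) -> forall x : M + N, answer x.

Definition play d (A : orderType d) (M N : Type) (sigma : strategy A M N)
    (x : A -> M + N) (a : A) : M * N :=
  matched (sigma a (fun b => x (sval b)) (x a)).

Definition winning d (A : orderType d) voc (M N : structure voc)
    (sigma : strategy A M N) : Prop :=
  forall x : A -> M + N,
    partial_iso (fun a => (play sigma x a).1) (fun a => (play sigma x a).2).

Definition EF_equivalent d (A : orderType d) voc (M N : structure voc) : Prop :=
  exists sigma : strategy A M N, winning sigma.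

Section ReducedPower.
Variables (I : Type) (D : set_system I) (FD : Filter D).
Variables (voc : vocabulary) (M : structure voc).

Definition eq_mod (f g : {classic (I -> M)}) : bool :=
  `[< D [set i | f i = g i] >].

Lemma eq_mod_refl : reflexive eq_mod.
Proof.
by move=> f; apply/asboolP; apply: filterS filterT => i _ /=.
Qed.

Lemma eq_mod_sym : symmetric eq_mod.
Proof.
move=> f g; apply/asbool_equiv_eq.
by split; apply: filterS => i /= ->.
Qed.

Lemma eq_mod_trans : transitive eq_mod.
Proof.
move=> g f h /asboolP fg /asboolP gh; apply/asboolP.
by apply: filterS (filterI fg gh) => i /= [-> ->].
Qed.

Canonical eq_mod_equiv := EquivRel eq_mod eq_mod_refl eq_mod_sym eq_mod_trans.

Definition reduced_power_carrier : Type := {eq_quot eq_mod_equiv}.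

Definition rp_class (f : I -> M) : reduced_power_carrier :=
  \pi_({eq_quot eq_mod_equiv}) (f : {classic (I -> M)}).

Definition rp_repr (c : reduced_power_carrier) : I -> M :=
  repr (c : {eq_quot eq_mod_equiv}).

(* The interpretations go through chosen representatives; [rp_finterpE] and
   [rp_rinterpE] below show that they do not depend on the choice. *)
Definition rp_finterp (s : fsym voc)
    (c : 'I_(farity s) -> reduced_power_carrier) : reduced_power_carrier :=
  rp_class (fun i => finterp (fun k => rp_repr (c k) i)).

Definition rp_rinterp (s : rsym voc)
    (c : 'I_(rarity s) -> reduced_power_carrier) : Prop :=
  D [set i | rinterp (fun k => rp_repr (c k) i)].

Lemma rp_inhabited : inhabited reduced_power_carrier.
Proof. by case: (carrier_inhabited M) => m; exists; exact: rp_class (fun=> m). Qed.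

Definition reduced_power : structure voc :=
  Structure rp_finterp rp_rinterp rp_inhabited.

Lemma rp_reprK c : rp_class (rp_repr c) = c.
Proof. exact: reprK. Qed.

Lemma rp_classE f g : rp_class f = rp_class g <-> D [set i | f i = g i].
Proof.
split=> [/eqmodP/asboolP//|fg].
by apply/eqmodP/asboolP.
Qed.

Lemma rp_repr_class f : D [set i | rp_repr (rp_class f) i = f i].
Proof. by apply/rp_classE; rewrite rp_reprK. Qed.

Lemma rp_repr_classes n (f : 'I_n -> I -> M) :
  D [set i | (fun k => rp_repr (rp_class (f k)) i) = f ^~ i].
Proof.
have H (s : seq 'I_n) :
    D [set i | forall k, k \in s -> rp_repr (rp_class (f k)) i = f k i].
  elim: s => [|k s IHs]; first by apply: filterS filterT => i _ k /=.
  apply: filterS (filterI (rp_repr_class (f k)) IHs) => i /= [ik sE] j.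
  by rewrite inE => /predU1P[->//|/sE].
apply: filterS (H (enum 'I_n)) => i /= Hi.
by apply/funext => k; rewrite Hi// mem_enum.
Qed.

Lemma rp_finterpE (s : fsym voc) (f : 'I_(farity s) -> I -> M) :
  rp_finterp (fun k => rp_class (f k)) =
  rp_class (fun i => finterp (fun k => f k i)).
Proof.
by apply/rp_classE; apply: filterS (rp_repr_classes f) => i /= ->.
Qed.

Lemma rp_rinterpE (s : rsym voc) (f : 'I_(rarity s) -> I -> M) :
  rp_rinterp (fun k => rp_class (f k)) <->
  D [set i | rinterp (fun k => f k i)].
Proof.
by split=> H; apply: filterS (filterI (rp_repr_classes f) H) => i /= [->].
Qed.

End ReducedPower.

(* Main.v *)
(** Fix for each [a : K] an injection [g a] of the elements below [a] into the
  cardinal [L], and let [active a i] consist of [a] and of the [b < a] with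
  [g a b < i]: a set of rounds of size less than [L].  In round [a], II plays
  coordinatewise: at coordinate [i] she follows her strategy for [M] and [N] in
  the play whose moves are the [i]-th coordinates of the moves of I in the
  rounds [active a i], listed in increasing order along [L] by [rank].
  For [a <= c] there are club many [i] at which [active a i] is an initial
  segment of [active c i], so finitely many rounds belong to a single play of
  the short game at [D]-almost every coordinate.  An atomic formula only
  involves finitely many rounds, and Los's theorem for atomic formulas
  concludes. *)

From HB Require Import structures.
Require Import Defs.
From mathcomp Require Import all_boot all_order.
From mathcomp Require Import all_classical wochoice.

Set Implicit Arguments.
Unset Strict Implicit.
Unset Printing Implicit Defensive.

Import Order.TTheory.
Local Open Scope order_scope.
Local Open Scope classical_set_scope.
Local Open Scope card_scope.

Lemma card_le_inj T U (u0 : U) (A : set T) :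
  A #<= [set: U] -> exists f : T -> U, {in A &, injective f}.
Proof.
pose pU := HB.pack_for pointedType U (gen_eqMixin U) (gen_choiceMixin U)
  (isPointed.Build U u0).
by move=> AU; apply/(@pcard_injP _ pU).
Qed.

(** * Least elements and well-foundedness of ordinals *)

Section WellOrder.
Variables (d : Order.disp_t) (A : orderType d).
Hypothesis ordA : is_ordinal A.

Lemma ordinal_min (P : set A) :
  P !=set0 -> exists2 m, P m & forall a, P a -> m <= a.
Proof.
move=> [a Pa]; have [|m [[mP mle] _]] := ordA (A := [pred x | `[< P x >]]).
  by exists a; apply/asboolP.
by exists m => [|b Pb]; [exact/asboolP|apply: mle; exact/asboolP].
Qed.

Lemma ordinal_wf : well_founded (fun a b : A => a < b).
Proof.
move=> a; apply: contrapT => na.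
have [|m nm mle] := @ordinal_min [set x | ~ Acc (fun a b : A => a < b) x].
  by exists a.
apply: nm; split=> b bm; apply: contrapT => /mle.
by rewrite leNgt bm.
Qed.

End WellOrder.

(** * Order-preserving ranks of the elements of a small set *)

Section Rank.
Variables (d d' : Order.disp_t) (K : orderType d) (L : orderType d').
Hypothesis ordK : is_ordinal K.
Variables (l0 : L).

(** Any strict upper bound of the earlier ranks serves, not just the least one, so positions may
    have gaps; [l0] is the value when no bound exists. *)
Definition rank (T : set K) : K -> L :=
  Fix (ordinal_wf ordK) (fun=> L) (fun a rec =>
    xget l0 [set l | forall b (ba : b < a), T b -> rec b ba < l]).

Lemma rankE T a :
  rank T a = xget l0 [set l | forall b, b < a -> T b -> rank T b < l].
Proof.
rewrite {1}/rank Fix_eq// => x f g fg; congr xget.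
by apply/seteqP; split=> l /= H b bx Tb; have := H b bx Tb; rewrite fg.
Qed.

(** By induction the sets of admissible bounds coincide, and [xget] makes the same choice from equal
    sets. *)
Lemma rank_local (T T' : set K) a :
  (forall b, b < a -> T b <-> T' b) -> rank T a = rank T' a.
Proof.
elim/(well_founded_ind (ordinal_wf ordK)): a => a IHa TT'.
have E b : b < a -> rank T b = rank T' b.
  by move=> ba; apply: IHa => // c cb; apply: TT'; exact: lt_trans ba.
rewrite !rankE; congr xget; apply/seteqP; split=> l /= H b ba /(TT' _ ba) Tb.
  by rewrite -E//; exact: H.
by rewrite E//; exact: H.
Qed.

(** The smallness hypothesis on [T], applied to the rank itself, keeps [xget] from falling back on
    [l0]. *)
Lemma rank_lt (T : set K) a b :
    (forall f : K -> L, exists l, forall c, T c -> f c < l) ->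
  T a -> a < b -> rank T a < rank T b.
Proof.
move=> /(_ (rank T))[l lP] Ta ab; rewrite [ltRHS]rankE.
apply: (@xgetPex _ l0 [set l | forall c, c < b -> T c -> rank T c < l]) => //.
by exists l => c _ /lP.
Qed.

End Rank.

(** * Bounded sets and clubs in a regular cardinal *)

Section Regular.
Variables (d : Order.disp_t) (L : orderType d).
Hypothesis regL : is_regular L.

(** Without a strict upper bound [C] would be unbounded, hence of the size of [L]. *)
Lemma regular_bounded (C : set L) :
  ~ ([set: L] #<= C) -> exists l, forall c, C c -> c < l.
Proof.
move=> nLC; case: regL => _ _ unbL; apply: contrapT => nb; apply: nLC.
suff /unbL : unbounded C by move/card_esym/(card_eqPle _ _) => [].
move=> a; apply: contrapT => na; apply: nb; exists a => c Cc.
by rewrite ltNge; apply/negP => ac; apply: na; exists c.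
Qed.

Lemma regular_small_bounded T (S : set T) (i : L) (f : T -> L) :
  S #<= below i -> exists l, forall s, S s -> f s < l.
Proof.
move=> Si; have [|l lP] := @regular_bounded (f @` S).
  move=> Lf; have [[_ ni] _ _] := regL; apply: (ni i).
  exact: card_le_trans Lf (card_le_trans (card_image_le _ _) Si).
by exists l => s Ss; apply: lP; exists s.
Qed.

Lemma regular_finite_bounded (C : set L) :
  finite_set C -> exists l, forall c, C c -> c < l.
Proof.
move=> finC; apply: regular_bounded => /card_le_finite /(_ finC).
by have [_ ? _] := regL.
Qed.

Lemma regular_no_max (a : L) : exists b, a < b.
Proof.
have [b bP] := regular_finite_bounded (finite_set1 a).
by exists b; exact: bP.
Qed.

Lemma ray_club (j : L) : is_club [set i | j < i].
Proof.
split=> [a [[b ba] _] /(_ b ba)[c [/= jc _ ca]]|a]; first exact: lt_trans ca.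
have [b] := regular_no_max (Order.max j a); rewrite gt_max => /andP[jb ab].
by exists b => //; exact: ltW.
Qed.

Hypothesis uncountableL : ~ countable [set: L].

(** For unboundedness, iterate from [a] a bound of [phi] on initial segments. The countably many
    iterates are bounded, [L] being regular and uncountable, and their supremum is closed under
    [phi]. *)
Lemma closure_points_club (phi : L -> L) :
  is_club [set i | forall j, j < i -> phi j < i].
Proof.
split=> [a [_ lima] cof j ja|a].
  have [b jb ba] := lima _ ja; have [c [Cc bc ca]] := cof _ ba.
  by apply: lt_trans ca; apply: Cc; exact: lt_le_trans bc.
have step l : exists l', forall j, j < l -> phi j < l'.
  exact: (@regular_small_bounded L (below l) l phi (card_lexx _)).
pose s := fun n => iter n (fun l => projT1 (cid (step l))) a.
have sP n j : j < s n -> phi j < s n.+1.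
  by move=> jn; rewrite /s iterS; case: cid => l' /=; exact.
have [|l lP] := @regular_bounded (range s).
  move=> Ls; apply: uncountableL; apply: card_le_trans Ls _.
  exact: card_image_le.
have [[ordL _] _ _] := regL.
have [|m mP mle] := @ordinal_min _ L ordL [set m | forall n, s n <= m].
  by exists l => n; apply/ltW/lP; exists n.
exists m => /= [j jm|]; last exact: (mP 0%N).
have [n jn] : exists n, j < s n.
  apply: contrapT => nj; move: jm; rewrite ltNge => /negP; apply.
  apply: mle => n.
  by rewrite leNgt; apply/negP => ?; apply: nj; exists n.
exact: lt_le_trans (sP _ _ jn) (mP _).
Qed.

End Regular.

(** * Renaming and finite support of atomic formulas *)

Section Atomic.
Variables (voc : vocabulary).

Fixpoint term_rename V W (f : V -> W) (t : term voc V) : term voc W :=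
  match t with
  | Var v => Var voc (f v)
  | App s ts => App (fun k => term_rename f (ts k))
  end.

Definition atomic_rename V W (f : V -> W) (p : atomic voc V) : atomic voc W :=
  match p with
  | Equal t u => Equal (term_rename f t) (term_rename f u)
  | Rel s ts => Rel (fun k => term_rename f (ts k))
  end.

Lemma eval_rename V W (f : V -> W) (M : structure voc) (e : W -> M) t :
  eval e (term_rename f t) = eval (e \o f) t.
Proof. by elim: t => //= s ts IHts; congr finterp; apply/funext. Qed.

Lemma sat_rename V W (f : V -> W) (M : structure voc) (e : W -> M) p :
  sat e (atomic_rename f p) <-> sat (e \o f) p.
Proof.
case: p => /= [t u|s ts]; first by rewrite !eval_rename.
by under eq_fun do rewrite eval_rename.
Qed.

(** Later [f] sends rounds of the long game to rounds of the short one. *)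
Lemma partial_iso_comp V W (f : V -> W) (M N : structure voc)
    (e : W -> M) (e' : W -> N) :
  partial_iso e e' -> partial_iso (e \o f) (e' \o f).
Proof.
by move=> ee' p; have := ee' (atomic_rename f p); rewrite !sat_rename.
Qed.

Lemma term_support (V : eqType) (t : term voc V) :
  exists s : seq V, forall (M : structure voc) (e e' : V -> M),
    {in s, e =1 e'} -> eval e t = eval e' t.
Proof.
elim: t => [v|f ts /choice[s sP]] /=.
  by exists [:: v] => M e e'; apply; rewrite inE.
exists (flatten [seq s k | k <- enum 'I_(farity f)]) => M e e' ee'.
congr finterp; apply/funext => k; apply: sP => v vs; apply: ee'.
by apply/flatten_mapP; exists k; rewrite ?mem_enum.
Qed.

(** Arities are finite. Finite support matters because [D] is closed under finite intersections. *)
Lemma atomic_support (V : eqType) (p : atomic voc V) :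
  exists s : seq V, forall (M : structure voc) (e e' : V -> M),
    {in s, e =1 e'} -> sat e p <-> sat e' p.
Proof.
case: p => [t u|r ts] /=.
  have [[s sP] [s' s'P]] := (term_support t, term_support u).
  exists (s ++ s') => M e e' ee'.
  rewrite (sP _ e e') ?(s'P _ e e')// => v vs; apply: ee'.
    by rewrite mem_cat vs orbT.
  by rewrite mem_cat vs.
have /choice[s sP] := fun k => term_support (ts k).
exists (flatten [seq s k | k <- enum 'I_(rarity r)]) => M e e' ee'.
suff -> : (fun k => eval e (ts k)) = (fun k => eval e' (ts k)) by [].
apply/funext => k; apply: sP => v vs; apply: ee'.
by apply/flatten_mapP; exists k; rewrite ?mem_enum.
Qed.

(** * Los's theorem for atomic formulas *)

Section Los.
Variables (I : Type) (D : set_system I) (FD : Filter D).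

Lemma eval_reduced_power V (M : structure voc) (e : V -> I -> M)
    (t : term voc V) :
  eval (M := reduced_power FD M) (fun v => rp_class FD (e v)) t =
  rp_class FD (fun i => eval (e ^~ i) t).
Proof.
elim: t => //= s ts IHts; rewrite -rp_finterpE; congr rp_finterp.
exact/funext.
Qed.

Lemma sat_reduced_power V (M : structure voc) (e : V -> I -> M)
    (p : atomic voc V) :
  sat (M := reduced_power FD M) (fun v => rp_class FD (e v)) p <->
  D [set i | sat (e ^~ i) p].
Proof.
case: p => [t u|s ts] /=; first by rewrite !eval_reduced_power rp_classE.
rewrite -rp_rinterpE.
by under [X in rp_rinterp X]eq_fun do rewrite eval_reduced_power.
Qed.

Lemma filter_all (V : eqType) (P : V -> I -> Prop) (s : seq V) :
  (forall v, v \in s -> D [set i | P v i]) ->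
  D [set i | forall v, v \in s -> P v i].
Proof.
elim: s => [_|v s IHs sP]; first by apply: filterS filterT => i _ v.
have vs : forall w, w \in s -> D [set i | P w i].
  by move=> w ws; apply: sP; rewrite inE ws orbT.
apply: filterS (filterI (sP v (mem_head _ _)) (IHs vs)) => i /= [Pv Ps] w.
by rewrite inE => /predU1P[->//|/Ps].
Qed.

End Los.
End Atomic.

(** * Active rounds and their coherence *)

Section Transfer.
Variables (d d' : Order.disp_t) (L : orderType d) (K : orderType d').
Hypotheses (regL : is_regular L) (uncountableL : ~ countable [set: L]).
Hypothesis ordK : is_ordinal K.
Variables (D : set_system L) (FD : Filter D).
Hypothesis clubD : forall C : set L, is_club C -> D C.
Variable g : K -> K -> L.
Hypothesis g_inj : forall a, {in below a &, injective (g a)}.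
Variables (l0 : L) (k0 : K).
Hypothesis k0_min : forall a, k0 <= a.

Definition active (a : K) (i : L) : set K :=
  [set b | b <= a /\ (b = a \/ g a b < i)].

(** The map [g a] injects the active rounds before [a] into [below i], and [a] itself adds one more
    value. The form is that of the hypothesis of [rank_lt]. *)
Lemma active_small a i (f : K -> L) :
  exists l, forall b, active a i b -> f b < l.
Proof.
pose S := [set b | b < a /\ g a b < i].
have [|l lP] := @regular_small_bounded _ L regL K S i f.
  apply: card_le_trans (_ : g a @` S #<= _); last first.
    by apply: subset_card_le => _ [b [_ gbi] <-].
  suff /card_eqPle[] : g a @` S #= S by []; apply: inj_card_eq.
  by move=> b c /set_mem[ba _] /set_mem[ca _]; apply: g_inj; exact: mem_set.
have [l' l'P] := regular_finite_bounded regL (finite_set1 (f a)).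
exists (Order.max l l') => b [ba ab]; rewrite lt_max.
have [->|nba] := eqVneq b a; first by rewrite l'P ?orbT.
rewrite lP//; split; first by rewrite lt_neqAle nba.
by case: ab => // bE; rewrite bE eqxx in nba.
Qed.

Definition coherent (c : K) (i : L) (a : K) : Prop :=
  active c i a /\ forall b, b <= a -> active a i b <-> active c i b.

(* Above [g c a], coherence is closure of [i] under the partial bijection
   between the codes of [b < a] given by [g a] and by [g c]. *)
Lemma coherent_large a c : a <= c -> D [set i | coherent c i a].
Proof.
rewrite le_eqVlt => /predU1P[->|ac].
  by apply: filterS filterT => i _; split=> // ; split=> //; left.
(* Outside the codes [xget] returns [k0], and the resulting values are arbitrary. *)
pose h' j := g c (xget k0 [set b | b < a /\ g a b = j]).
pose h'' j := g a (xget k0 [set b | b < a /\ g c b = j]).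
have h'E b : b < a -> h' (g a b) = g c b.
  move=> ba; rewrite /h' (xget_unique k0 (x := b))// => e [ea gE].
  by apply: g_inj gE; exact: mem_set.
have h''E b : b < a -> h'' (g c b) = g a b.
  move=> ba; rewrite /h'' (xget_unique k0 (x := b))// => e [ea gE].
  by apply: g_inj gE; apply: mem_set; exact: lt_trans ac.
apply: filterS (filterI (clubD (ray_club regL (g c a)))
  (filterI (clubD (closure_points_club regL uncountableL h'))
           (clubD (closure_points_club regL uncountableL h'')))) => i /=.
move=> [gi [h'i h''i]]; split; first by split; [exact: ltW|right].
move=> b; rewrite le_eqVlt => /predU1P[->|ba].
  by split=> _; split; rewrite ?(ltW ac)//; [right|left].
split=> -[_] [bE|gb].
- by rewrite bE ltxx in ba.
- split; first exact: ltW (lt_trans ba ac).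
  right; rewrite -h'E//; exact: h'i.
- by have := lt_trans ba ac; rewrite bE ltxx.
- by split; [exact: ltW|right; rewrite -h''E//; exact: h''i].
Qed.

(** * The coordinatewise strategy of II *)

Variables (voc : vocabulary) (M N : structure voc).
Variable sigma : strategy L M N.
Hypothesis win_sigma : winning sigma.

Let RM := reduced_power FD M.
Let RN := reduced_power FD N.

Definition position (a : K) (i : L) : K -> L := rank ordK l0 (active a i).

Definition coordinate (x : RM + RN) (i : L) : M + N :=
  match x with inl c => inl (rp_repr c i) | inr c => inr (rp_repr c i) end.

(* The values at positions outside the range are irrelevant padding. *)
Definition coordinate_moves (x : K -> RM + RN) (a : K) (i l : L) : M + N :=
  coordinate (x (xget k0 [set b | active a i b /\ position a i b = l])) i.

Definition coordinate_history x a i (b : {b : L | b < position a i a}) :=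
  coordinate_moves x a i (sval b).

Definition coordinate_round (x : K -> RM + RN) (a : K) (i : L) : M * N :=
  matched (sigma (@coordinate_history x a i) (coordinate (x a) i)).

Definition respond (y : K -> RM + RN) (a : K) (x : RM + RN) : answer x :=
  match x return answer x with
  | inl c => rp_class FD (fun i =>
      sigma (@coordinate_history y a i) (inl (rp_repr c i)))
  | inr c => rp_class FD (fun i =>
      sigma (@coordinate_history y a i) (inr (rp_repr c i)))
  end.

(** The current move pads the history to a total sequence; in round [a] only its values up to [a]
    are read. *)
Definition extend T (a : K) (x : {b : K | b < a} -> T) (t : T) (b : K) : T :=
  match pselect (b < a) with left ba => x (exist _ b ba) | right _ => t end.

Definition power_strategy : strategy K RM RN :=
  fun a x t => respond (extend x t) a t.

Lemma coordinate_moves_local (x y : K -> RM + RN) a i :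
  (forall b, b <= a -> x b = y b) ->
  coordinate_moves x a i = coordinate_moves y a i.
Proof.
move=> xy; apply/funext => l; rewrite /coordinate_moves xy//.
(* The default round [k0] is least in [K], so padding also reads a round up to [a]. *)
by case: xgetP => [b _ [[]]|].
Qed.

Lemma play_power_strategy (x : K -> RM + RN) a :
  play power_strategy x a =
  (rp_class FD (fun i => (coordinate_round x a i).1),
   rp_class FD (fun i => (coordinate_round x a i).2)).
Proof.
rewrite /play /power_strategy /respond /coordinate_round.
set y := extend _ _.
have -> : @coordinate_history y a = @coordinate_history x a.
  apply/functional_extensionality_dep => i; apply/funext => l.
  rewrite /coordinate_history (@coordinate_moves_local y x)// => b ba.
  rewrite /y /extend; case: pselect => // /negP; rewrite -leNgt => ab.
  by congr x; apply: le_anti; rewrite ab.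
by case: (x a) => c /=; rewrite rp_reprK.
Qed.

Lemma position_lt c i a b :
  active c i a -> a < b -> position c i a < position c i b.
Proof. exact: rank_lt (@active_small c i). Qed.

Lemma position_coherent c i a b : coherent c i a -> b <= a ->
  position c i b = position a i b.
Proof.
move=> [_ ac] ba; apply: rank_local => e eb.
by rewrite ac// ltW// (lt_le_trans eb).
Qed.

(** By strict monotonicity, a round of [active c i] at a position below that of [a] cannot come
    after [a]; up to [a] both active sets and their positions agree. *)
Lemma coordinate_moves_coherent x c i a l : coherent c i a ->
  l < position a i a -> coordinate_moves x c i l = coordinate_moves x a i l.
Proof.
move=> coh la; rewrite /coordinate_moves; congr (coordinate (x (xget _ _)) i).
have [aca ac] := coh.
apply/seteqP; split=> b /= [actb bl].
  have ba : b <= a.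
    rewrite leNgt; apply/negP => /(position_lt aca).
    by rewrite bl (position_coherent coh)// ltNge ltW.
  by rewrite ac// -(position_coherent coh).
have ba : b <= a by case: actb.
by rewrite -ac// (position_coherent coh).
Qed.

Lemma coordinate_moves_position x c i a : active c i a ->
  coordinate_moves x c i (position c i a) = coordinate (x a) i.
Proof.
move=> aca; rewrite /coordinate_moves (xget_unique k0 (x := a))// => b [acb E].
have [/(position_lt acb)|/(position_lt aca)|//] := ltgtP b a; by rewrite E ltxx.
Qed.

(** The right-hand play depends on [c] but not on [a]: all rounds coherent with [c] at [i] belong to
    one play of [sigma]. *)
Lemma coordinate_round_play x c i a : coherent c i a ->
  coordinate_round x a i =
  play sigma (coordinate_moves x c i) (position c i a).
Proof.
move=> coh; have [aca ac] := coh; rewrite /play coordinate_moves_position//.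
rewrite /coordinate_round (position_coherent coh)//.
congr (matched (sigma _ _)).
apply/funext => -[l la]; rewrite /coordinate_history/=.
by rewrite (coordinate_moves_coherent x coh).
Qed.

Lemma power_strategy_winning : winning power_strategy.
Proof.
move=> x p; have [s sP] := atomic_support p.
(* A common bound of the rounds occurring in [p], whose active sets embed in that of [c] at almost
   every coordinate. *)
pose c := \big[Order.max/k0]_(a <- s) a.
have sc a : a \in s -> a <= c by move=> sa; exact: le_bigmax_seq.
have large : D [set i | sat (fun a => (coordinate_round x a i).1) p <->
                        sat (fun a => (coordinate_round x a i).2) p].
  have cohs := filter_all FD (fun a sa => coherent_large (sc a sa)).
  apply: filterS cohs => i /= coh.
  have E a : a \in s -> coordinate_round x a i =
      play sigma (coordinate_moves x c i) (position c i a).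
    by move=> sa; exact/coordinate_round_play/coh.
  pose e a := play sigma (coordinate_moves x c i) (position c i a).
  (* Outside [s] the assignments may differ, which does not affect [p]. *)
  rewrite (sP M _ (fun a => (e a).1)); last by move=> a /E /= ->.
  rewrite (sP N _ (fun a => (e a).2)); last by move=> a /E /= ->.
  exact: (partial_iso_comp (position c i) (win_sigma _)).
under eq_fun do rewrite play_power_strategy.
under [X in _ <-> sat X _]eq_fun do rewrite play_power_strategy.
rewrite /= !sat_reduced_power.
by split=> H; apply: filterS (filterI large H) => i /= [e12 /e12].
Qed.

End Transfer.

Theorem theorem1 (d d' : Order.disp_t) (L : orderType d) (K : orderType d')
  (regL : is_regular L) (uncountableL : ~ countable [set: L])
  (succK : is_succ_cardinal L K)
  (D : set_system L) (FD : Filter D)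
  (clubD : forall C : set L, is_club C -> D C)
  (voc : vocabulary) (M N : structure voc) :
  EF_equivalent L M N ->
  EF_equivalent K (reduced_power FD M) (reduced_power FD N).
Proof.
move=> [sigma win]; have [ordK nKL Kle] := succK.
have [k0 _ k0_min] : exists2 k : K, [set: K] k & forall a, [set: K] a -> k <= a.
  apply: ordinal_min => //; apply/set0P/eqP => K0.
  by apply: nKL; rewrite K0; exact: card_ge0.
have [l0 _] : [set: L] !=set0 by case: regL => _ /infinite_setN0.
(* Proper initial segments of the successor cardinal [K] have size at most that of [L]. *)
have /choice[g g_inj] (a : K) : exists f : K -> L, {in below a &, injective f}.
  exact: card_le_inj (Kle a).
exists (power_strategy ordK g l0 k0 sigma).
by apply: power_strategy_winning => // a; exact: k0_min.
Qed.
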